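(* Let $m\ge 1$, $n=m^2$, $A\in\mathbb{R}^{n\times n}$, $b\in\mathbb{R}^n$, $1<p<2$, $1\le k\le n$, and let $W_k\in\mathbb{R}^{n\times k}$ have orthonormal columns. Let $L\in\mathbb{R}^{2m(m-1)\times n}$ be the discrete gradient matrix defined in the context. Then the modified projection problem $$\min_{x\in\mathcal{B}}\|Lx\|_p,\qquad \mathcal{B}=\Bigl\{x\in\mathbb{R}^n : x \text{ minimizes } z\mapsto \|(A W_kW_k^T)z-b\|_2 \text{ over } z\in\mathbb{R}^n\Bigr\},$$ has a unique minimizer if and only if $$\mathcal{N}(AW_kW_k^T)\cap\mathcal{N}(L)=\{0\}.$$
   Context: $\|\cdot\|_p$ is the vector $p$-norm and $\mathcal{N}(\cdot)$ denotes the null space. The matrix $L$ is $$L=\begin{pmatrix}L_1\otimes I\\ I\otimes L_1\end{pmatrix}\in\mathbb{R}^{2m(m-1)\times m^2},$$ where $\otimes$ is the Kronecker product, $I$ is the $m\times m$ identity, and $L_1\in\mathbb{R}^{(m-1)\times m}$ is the first-difference matrix whose $i$-th row has $-1$ in position $i$, $1$ in position $i+1$, and zeros elsewhere. ''Has a unique minimizer'' means that there is exactly one $x\in\mathcal{B}$ attaining the minimum of $\|Lx\|_p$ over $\mathcal{B}$. *)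

(* Defs.v *)
From HB Require Import structures.
From mathcomp Require Export all_boot all_order all_algebra.
From mathcomp Require Export boolp classical_sets reals exp.
From mathcomp Require Export mxtens.

Set Implicit Arguments.
Unset Strict Implicit.
Unset Printing Implicit Defensive.

Import Order.TTheory GRing.Theory Num.Theory.

Local Open Scope classical_set_scope.
Local Open Scope ring_scope.

Definition pnorm (R : realType) (n : nat) (p : R) (x : 'cV[R]_n) : R :=
  (\sum_(i < n) `|x i 0| `^ p) `^ p^-1.

Definition nullspace (R : realType) (m n : nat) (M : 'M[R]_(m, n)) :
    set 'cV[R]_n :=
  [set x | M *m x = 0].

Definition orthonormal_columns (R : realType) (n k : nat) (W : 'M[R]_(n, k)) :
    Prop :=
  forall i j : 'I_k, \sum_(l < n) W l i * W l j = (i == j)%:R.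

Definition minimizers (R : realType) (T : Type) (f : T -> R) (D : set T) :
    set T :=
  [set x | D x /\ forall y, D y -> f x <= f y].

Definition first_diff (R : realType) (m : nat) : 'M[R]_(m.-1, m) :=
  \matrix_(i < m.-1, j < m)
    (if j == i :> nat then -1 else if j == i.+1 :> nat then 1 else 0).

(* The row count m.-1 * m + m * m.-1 is 2m(m - 1), and m * m is n = m^2. *)
Definition discrete_gradient (R : realType) (m : nat) :
    'M[R]_(m.-1 * m + m * m.-1, m * m) :=
  col_mx (first_diff R m *t 1%:M) (1%:M *t first_diff R m).

(* Main.v *)
(* For every exponent p > 1 the map x |-> |x|^p is strictly convex, so all
   minimizers of |L z - c|_p over a convex set have the same image under L.
   Minimizers over an affine subspace exist because the range of a matrix is
   closed and the objective has bounded sublevel sets on it.  Applied with p = 2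
   this makes the inner solution set a fiber of A W W^T; applied with the given
   p it makes the outer solution set a nonempty translate of the intersection of
   the two null spaces, which is a single point iff the intersection is zero. *)

Require Import Defs.
From mathcomp Require Import ring lra.
From mathcomp Require Import topology normedtype derive.

Set Implicit Arguments.
Unset Strict Implicit.
Unset Printing Implicit Defensive.

Import Order.TTheory GRing.Theory Num.Theory.
Import numFieldTopology.Exports numFieldNormedType.Exports.

Local Open Scope classical_set_scope.
Local Open Scope ring_scope.

(** * Strict convexity of the p-th power of the absolute value *)

Lemma ln_lt_sub1 (R : realType) (x : R) : 0 < x -> x != 1 -> ln x < x - 1.
Proof.
move=> x0 x1; rewrite ltrBrDl -[ltRHS](lnK x0) expR_gt1Dx//.
by rewrite ln_eq0.
Qed.

Lemma bernoulli_powR_lt (R : realType) (p u : R) :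
  1 < p -> 0 <= u -> u != 1 -> 1 + p * (u - 1) < u `^ p.
Proof.
move=> p1; rewrite le_eqVlt => /predU1P[<- _|u0 u1].
  by rewrite powR0; [lra | rewrite gt_eqF//; lra].
have [z0|z0] := leP (1 + p * (u - 1)) 0; first exact: le_lt_trans _ (powR_gt0 _ u0).
set z := 1 + _ in z0 *.
(* [u = z / p + (1 - 1 / p) * 1], so strict concavity of [ln] gives
   [ln z / p < ln u]; both tangents below are taken at [u]. *)
have lnz : ln (z / u) <= z / u - 1.
  have zu0 : 0 < z / u by rewrite divr_gt0.
  by rewrite -{1}(subrKC 1 (z / u)) le_ln1Dx//; lra.
have lnV : ln u^-1 < u^-1 - 1.
  by apply: ln_lt_sub1; rewrite ?invr_gt0// invr_eq1.
rewrite ln_div ?posrE// in lnz; rewrite lnV ?posrE// in lnV.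
rewrite -ltr_ln ?posrE ?powR_gt0// ln_powR.
have -> : p * ln u = ln u + (p - 1) * ln u by ring.
have h : (p - 1) * (- ln u) < (p - 1) * (u^-1 - 1) by rewrite ltr_pM2l//; lra.
(* The two tangent bounds cancel exactly, leaving [ln z < p * ln u]. *)
have : z / u - 1 + (p - 1) * (u^-1 - 1) = 0.
  by rewrite /z; field; rewrite gt_eqF.
lra.
Qed.

(** The Bernoulli inequality at [c / s], scaled by the p-th power of the midpoint [s], puts the
    tangent at [s] strictly below the power at [c]. Adding the cases [c = a] and [c = b] cancels the
    linear terms. *)
Lemma powR_midpoint_lt (R : realType) (p a b : R) :
  1 < p -> 0 <= a -> 0 <= b -> a != b ->
  ((a + b) / 2) `^ p < (a `^ p + b `^ p) / 2.
Proof.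
move=> p1 a0 b0 ab; set s := (a + b) / 2.
have s0 : 0 < s.
  rewrite divr_gt0// lt0r addr_ge0// andbT paddr_eq0//.
  by apply: contraNN ab => /andP[/eqP-> /eqP->].
have sN0 : s != 0 by rewrite gt_eqF.
have ratio (c : R) : 0 <= c -> c != s ->
    s `^ p * (1 + p * (c / s - 1)) < c `^ p.
  move=> c0 cs; have cs0 : 0 <= c / s by rewrite divr_ge0// ltW.
  rewrite -[c in ltRHS](divfK sN0 c) [ltLHS]mulrC.
  rewrite (powRM _ cs0 (ltW s0)).
  rewrite ltr_pM2r ?powR_gt0// bernoulli_powR_lt//.
  by rewrite -subr_eq0 -(divff sN0) -mulrBl mulf_neq0 ?invr_eq0// subr_eq0.
have as_ : a != s by apply: contraNN ab => /eqP e; apply/eqP; rewrite /s in e; lra.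
have bs : b != s by apply: contraNN ab => /eqP e; apply/eqP; rewrite /s in e; lra.
have := ratio _ a0 as_; have := ratio _ b0 bs.
have : s `^ p * (1 + p * (a / s - 1)) + s `^ p * (1 + p * (b / s - 1)) =
    2 * s `^ p.
  have -> : b = 2 * s - a by rewrite /s; field.
  by field.
lra.
Qed.

Lemma powR_norm_midpoint_lt (R : realType) (p a b : R) : 1 < p -> a != b ->
  `|(a + b) / 2| `^ p < (`|a| `^ p + `|b| `^ p) / 2.
Proof.
move=> p1 ab; have p0 : 0 < p by lra.
(* Equal absolute values with [a != b] force [b = - a]: the midpoint is 0 and the right side is
   positive. Otherwise the triangle inequality reduces to nonnegative arguments. *)
have [nab|nab] := eqVneq `|a| `|b|.
  have -> : b = - a.
    move/eqP: nab; rewrite eqr_norm2 (negbTE ab)/= => /eqP->.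
    by rewrite opprK.
  have a0 : a != 0.
    apply: contraNneq ab => a0.
    by move/esym/eqP: nab; rewrite a0 normr0 normr_eq0 eq_sym.
  rewrite subrr mul0r normrN normr0 powR0 ?gt_eqF// divr_gt0//.
  by rewrite addr_gt0// powR_gt0// normr_gt0.
apply: le_lt_trans _ (powR_midpoint_lt p1 (normr_ge0 a) (normr_ge0 b) nab).
rewrite (ge0_ler_powR (ltW p0)) ?nnegrE ?divr_ge0 ?addr_ge0//.
by rewrite normrM normfV normr_nat ler_pM2r ?invr_gt0// ler_normD.
Qed.

Lemma powR_norm_midpoint_le (R : realType) (p a b : R) : 1 < p ->
  `|(a + b) / 2| `^ p <= (`|a| `^ p + `|b| `^ p) / 2.
Proof.
move=> p1; have [->|ab] := eqVneq a b; last exact/ltW/powR_norm_midpoint_lt.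
by rewrite (_ : (b + b) / 2 = b) ?(_ : forall c : R, (c + c) / 2 = c)//;
  move=> *; field.
Qed.

Lemma sum_powR_midpoint_lt (R : realType) (n : nat) (p : R) (x y : 'cV[R]_n) :
  1 < p -> x != y ->
  \sum_(i < n) `|(2^-1 *: (x + y)) i 0| `^ p <
  (\sum_(i < n) `|x i 0| `^ p + \sum_(i < n) `|y i 0| `^ p) / 2.
Proof.
move=> p1 xy; have [i xyi] : exists i, x i 0 != y i 0.
  apply/existsP; apply: contraNT xy => /existsPn xy.
  by apply/eqP/colP => i; apply/eqP; have := xy i; rewrite negbK.
have mid j : (2^-1 *: (x + y)) j 0 = (x j 0 + y j 0) / 2.
  by rewrite !mxE mulrC.
rewrite -big_split/= mulr_suml (bigD1 i)//= [ltRHS](bigD1 i)//=.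
apply: ltr_leD; first by rewrite mid powR_norm_midpoint_lt.
by apply: ler_sum => j _; rewrite mid powR_norm_midpoint_le.
Qed.

(** * Monotonicity and continuity of power sums *)

(** Trades the norm, which is not strictly convex along rays, for the power sum, which is. The outer
    power [p^-1] is strictly increasing on nonnegative reals. *)
Lemma ler_pnorm (R : realType) (n : nat) (p : R) (x y : 'cV[R]_n) : 0 < p ->
  (pnorm p x <= pnorm p y) =
  (\sum_(i < n) `|x i 0| `^ p <= \sum_(i < n) `|y i 0| `^ p).
Proof.
move=> p0; have pV0 : 0 < p^-1 by rewrite invr_gt0.
have S0 (z : 'cV[R]_n) : \sum_(i < n) `|z i 0| `^ p \is Num.nneg.
  by rewrite nnegrE sumr_ge0// => i _; exact: powR_ge0.
apply/idP/idP; last by apply: ge0_ler_powR; rewrite // ltW.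
by apply: contraTT; rewrite -!ltNge; apply: gt0_ltr_powR.
Qed.

Lemma continuous_powR_norm (R : realType) (p : R) : 0 < p ->
  continuous (fun x : R => `|x| `^ p).
Proof.
move=> p0 x; have [->|x0] := eqVneq x 0; last first.
  have nx0 : 0 < `|x| by rewrite normr_gt0.
  apply: (@continuous_comp R R R Num.norm (fun y : R => y `^ p)).
    exact: norm_continuous.
  apply/differentiable_continuous/derivable1_diffP/derivable_powR.
  by rewrite in_itv/= nx0.
apply/cvgrPdist_lt => /= e e0; rewrite normr0 powR0 ?gt_eqF//.
near=> y; rewrite sub0r normrN ger0_norm ?powR_ge0//.
(* Writing [e] as (e^(1/p))^p shows that e^(1/p) is a suitable radius around 0. *)
rewrite -[ltRHS](powRr1 (ltW e0)) -[X in e `^ X](mulVf (lt0r_neq0 p0)) powRrM.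
rewrite gt0_ltr_powR ?nnegrE ?powR_ge0//.
near: y; have := @nbhs0_lt R R (e `^ p^-1); apply.
exact: powR_gt0.
Unshelve. all: by end_near. Qed.

Lemma continuous_sumr (R : realType) (T : topologicalType) (n : nat)
  (F : 'I_n -> T -> R) : (forall i, continuous (F i)) ->
  continuous (fun x => \sum_(i < n) F i x).
Proof.
move=> cF; apply: continuous_big => [x|i _]; last exact: cF.
exact: add_continuous.
Qed.

(** * Minimizers of p-norm residuals *)

(** If the images differed, the midpoint, which lies in [D], would have a power sum strictly below
    the average of two minimal ones. *)
Lemma pnorm_minimizers_image_eq (R : realType) (q n : nat) (p : R)
    (L : 'M[R]_(q, n)) (c : 'cV[R]_q) (D : set 'cV[R]_n) (x y : 'cV[R]_n) :
  1 < p -> D (2^-1 *: (x + y)) ->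
  minimizers (fun z => pnorm p (L *m z - c)) D x ->
  minimizers (fun z => pnorm p (L *m z - c)) D y ->
  L *m x = L *m y.
Proof.
move=> p1 Dm [Dx minx] [Dy miny]; have p0 : 0 < p by lra.
have [/addIr//|xy] := eqVneq (L *m x - c) (L *m y - c).
have /= := minx _ Dm; rewrite (ler_pnorm _ _ p0) => leqx.
have /= := miny _ Dm; rewrite (ler_pnorm _ _ p0) => leqy.
exfalso; move: leqx leqy.
have -> : L *m (2^-1 *: (x + y)) - c =
    2^-1 *: ((L *m x - c) + (L *m y - c)).
  rewrite -scalemxAr mulmxDr; move: (L *m x) (L *m y) => u v.
  by apply/colP => i; rewrite !mxE; field.
have := sum_powR_midpoint_lt p1 xy; lra.
Qed.

(** The row space is cut out by finitely many linear equations, one for each column of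
    [cokermx M]. *)
Lemma closed_rowspace (R : realType) (r q : nat) (M : 'M[R]_(r, q)) :
  closed [set v : 'rV[R]_q | (v <= M)%MS].
Proof.
have -> : [set v : 'rV[R]_q | (v <= M)%MS] =
    \bigcap_(j in [set: 'I_q])
      (fun v : 'rV[R]_q => \sum_(i < q) v 0 i * cokermx M i j) @^-1` [set 0].
  apply/seteqP; split => v /=; rewrite submxE.
    by move=> /eqP/rowP vM j _; have := vM j; rewrite !mxE.
  by move=> vM; apply/eqP/rowP => j; have := vM j I; rewrite !mxE.
apply: closed_bigI => j _; apply: preimage_closed; last exact: closed_eq.
move=> v _; apply: continuous_sumr => i w.
by apply: continuousM; [exact: coord_continuous | exact: cst_continuous].
Qed.

(** The search runs over images [v], the transposes of [L *m z]: sublevel sets in [z] are unbounded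
    when [L] has a kernel, whereas those in [v] are bounded, so the extreme value theorem
    applies. *)
Lemma pnorm_minimizers_nonempty (R : realType) (q n : nat) (p : R)
    (L : 'M[R]_(q, n)) (c : 'cV[R]_q) : 0 < p ->
  minimizers (fun z => pnorm p (L *m z - c)) setT !=set0.
Proof.
move=> p0; pose g (v : 'rV[R]_q) := \sum_(i < q) `|v 0 i - c i 0| `^ p.
have g_ge0 v : 0 <= g v by apply: sumr_ge0 => i _; exact: powR_ge0.
(* When [g v <= g 0], each summand of [g v] is at most [g 0], so each coordinate of [v] is within
   [r] of that of [c]. *)
pose r := g 0 `^ p^-1.
pose box := [set v : 'rV[R]_q | forall i,
  `[c i 0 - r, c i 0 + r]%classic (v ord0 i)].
pose S := [set v : 'rV[R]_q | (v <= L^T)%MS].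
have boxP v : g v <= g 0 -> box v.
  move=> gv i /=; rewrite in_itv/= -ler_distl.
  have term : `|v ord0 i - c i 0| `^ p <= g 0.
    apply: le_trans gv; rewrite /g (bigD1 i)//= lerDl.
    by apply: sumr_ge0 => j _; exact: powR_ge0.
  have := @ge0_ler_powR R p^-1; rewrite invr_ge0 => /(_ (ltW p0)).
  move=> /(_ _ _ _ _ term); rewrite !nnegrE powR_ge0 g_ge0 -powRrM.
  by rewrite divff ?gt_eqF// powRr1//; apply.
have cbox : compact (box `&` S).
  apply: compact_closedI; last exact: closed_rowspace.
  apply: (@rV_compact R q (fun i => `[c i 0 - r, c i 0 + r]%classic)) => i.
  exact: segment_compact.
have S0 : (box `&` S) !=set0 by exists 0; split; [exact: boxP|exact: sub0mx].
have cg : continuous g.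
  apply: continuous_sumr => i v.
  apply: (@continuous_comp 'rV[R]_q R R (fun v : 'rV[R]_q => v 0 i - c i 0)
    (fun x : R => `|x| `^ p)); last exact: continuous_powR_norm.
  by apply: continuousB; [exact: coord_continuous | exact: cst_continuous].
have [v] := EVT_min_rV S0 cbox (continuous_subspaceT cg).
rewrite inE => -[_ /submxP[u vE]] vmin.
exists u^T; split=> [//|z _ /=]; rewrite (ler_pnorm _ _ p0).
have gE (t : 'cV[R]_n) :
    \sum_(i < q) `|(L *m t - c) i 0| `^ p = g (t^T *m L^T).
  by apply: eq_bigr => i _; rewrite -trmx_mul !mxE.
rewrite !gE trmxK -vE.
(* An image that may fall outside the box has a larger value than 0, which belongs to [box] and
   [S]. *)
have [gz|gz] := leP (g (z^T *m L^T)) (g 0).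
  by apply: vmin; rewrite inE; split; [exact: boxP | exact: submxMl].
apply: le_trans (ltW gz); apply: vmin; rewrite inE.
by split; [exact: boxP | exact: sub0mx].
Qed.

Lemma least_pnorm_solutionsE (R : realType) (r n : nat) (p : R)
    (M : 'M[R]_(r, n)) (b : 'cV[R]_r) (x : 'cV[R]_n) : 1 < p ->
  minimizers (fun z => pnorm p (M *m z - b)) setT x ->
  minimizers (fun z => pnorm p (M *m z - b)) setT = [set y | M *m y = M *m x].
Proof.
move=> p1 minx; apply/seteqP; split => y.
  by move=> miny; apply: (pnorm_minimizers_image_eq p1 _ miny minx).
case: minx => _ minx /= yx; split=> [//|z _]; rewrite yx; exact: minx.
Qed.

(** The columns of [K] span the null space of [M] ([kermx] is a left kernel, hence the transposes).
    Writing the fiber as [x + K *m t] gives an unconstrained problem in [t] with matrix [L *m K] and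
    target [- (L *m x)]. *)
Lemma pnorm_minimizers_fiber_nonempty (R : realType) (r q n : nat) (p : R)
    (M : 'M[R]_(r, n)) (L : 'M[R]_(q, n)) (x : 'cV[R]_n) : 0 < p ->
  minimizers (fun z => pnorm p (L *m z)) [set y | M *m y = M *m x] !=set0.
Proof.
move=> p0; pose K := (kermx M^T)^T.
have MK : M *m K = 0 by apply: trmx_inj; rewrite trmx_mul trmxK mulmx_ker trmx0.
have [u [_ minu]] := pnorm_minimizers_nonempty (L *m K) (- (L *m x)) p0.
have LE t : L *m (x + K *m t) = L *m K *m t - - (L *m x).
  by rewrite opprK mulmxDr mulmxA addrC.
exists (x + K *m u); split; first by rewrite /= mulmxDr mulmxA MK mul0mx addr0.
move=> y /= yx; have /submxP[w wE] : ((y - x)^T <= kermx M^T)%MS.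
  by apply/sub_kermxP; rewrite -trmx_mul mulmxBr yx subrr trmx0.
have -> : y = x + K *m w^T.
  by rewrite -trmx_mul -wE trmxK subrKC.
rewrite !LE; exact: minu.
Qed.

Lemma unique_pnorm_minimizer_iff (R : realType) (r q n : nat) (p s : R)
    (M : 'M[R]_(r, n)) (b : 'cV[R]_r) (L : 'M[R]_(q, n)) :
  1 < p -> 1 < s ->
  (exists! x : 'cV[R]_n, minimizers (fun z => pnorm p (L *m z))
     (minimizers (fun z => pnorm s (M *m z - b)) setT) x)
  <-> nullspace M `&` nullspace L = [set 0].
Proof.
move=> p1 s1; have p0 : 0 < p by lra.
have s0 : 0 < s by lra.
have [x0 /(least_pnorm_solutionsE s1) ->] := pnorm_minimizers_nonempty M b s0.
split=> [[x [[Bx minx] uniqx]]|MLT].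
  apply/seteqP; split=> [h [/= Mh Lh]|h ->]; last by split; exact: mulmx0.
  (* Adding [h] to [x] changes neither its image under [M] nor the objective, so [x + h] is a
     minimizer too and uniqueness gives [h = 0]. *)
  apply: (addrI x); rewrite addr0; apply/esym/uniqx.
  split; first by rewrite /= mulmxDr Mh addr0.
  move=> y By; rewrite mulmxDr Lh addr0; exact: minx.
have [x minx] := pnorm_minimizers_fiber_nonempty M L x0 p0.
exists x; split=> // y miny.
have shift z :
    minimizers (fun z => pnorm p (L *m z)) [set y | M *m y = M *m x0] z ->
    minimizers (fun z => pnorm p (L *m z - 0)) [set y | M *m y = M *m x0] z.
  move=> [Bz minz]; split=> [//|t Bt]; rewrite !subr0; exact: minz.
have Mxy : M *m x = M *m y by rewrite minx.1 miny.1.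
have Lxy : L *m x = L *m y.
  apply: (pnorm_minimizers_image_eq p1 _ (shift _ minx) (shift _ miny)).
  rewrite /= -scalemxAr mulmxDr minx.1 miny.1; move: (M *m x0) => u.
  by apply/colP => i; rewrite !mxE; field.
(* Two minimizers agree under [M] by feasibility and under [L] by strict convexity. *)
have : (nullspace M `&` nullspace L) (x - y).
  by split; rewrite /nullspace/= mulmxBr ?Mxy ?Lxy subrr.
by rewrite MLT => /= /subr0_eq.
Qed.

Theorem theorem2p2 (R : realType) (m : nat) (hm : (1 <= m)%N)
    (A : 'M[R]_(m * m)) (b : 'cV[R]_(m * m))
    (p : R) (hp1 : 1 < p) (hp2 : p < 2)
    (k : nat) (hk1 : (1 <= k)%N) (hkn : (k <= m * m)%N)
    (W : 'M[R]_(m * m, k)) (hW : orthonormal_columns W) :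
  let L := discrete_gradient R m in
  let B := minimizers (fun z : 'cV[R]_(m * m) =>
             pnorm 2 ((A *m W *m W^T) *m z - b)) setT in
  (exists! x : 'cV[R]_(m * m), minimizers (fun z => pnorm p (L *m z)) B x)
  <-> nullspace (A *m W *m W^T) `&` nullspace L = [set 0].
Proof.
by apply: unique_pnorm_minimizer_iff; [exact: hp1 | rewrite ltr1n].
Qed.
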